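(* Let $M$ be a monoid. The following are equivalent: (1) $M$ is weakly right noetherian; (2) every finitely generated right $M$-act is noetherian.
   Context: A right ideal of $M$ is a subset $I\subseteq M$ with $IM\subseteq I$; it is finitely generated if $I=XM$ for some finite $X\subseteq I$. A monoid is weakly right noetherian if every right ideal of it is finitely generated. A right $M$-act is a non-empty set $A$ with a map $A\times M\to A$, $(a,m)\mapsto am$, such that $a(mn)=(am)n$ and $a1=a$ for all $a\in A$, $m,n\in M$. A subset $B\subseteq A$ is a subact if $bm\in B$ for all $b\in B$, $m\in M$. An $M$-act $A$ is finitely generated if $A=UM$ for some finite $U\subseteq A$. An $M$-act is noetherian if every subact of it is finitely generated (equivalently, it satisfies the ascending chain condition on subacts). *)

(* Defs.v *)
From HB Require Import structures.
From mathcomp Require Import all_boot.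
From mathcomp Require Import boolp classical_sets cardinality.

Set Implicit Arguments.
Unset Strict Implicit.
Unset Printing Implicit Defensive.

Local Open Scope group_scope.
Local Open Scope classical_set_scope.

HB.mixin Record isRightAct (M : monoidType) (A : Type) := {
  act : A -> M -> A;
  actM : forall a m n, act a (m * n) = act (act a m) n;
  act1 : forall a, act a 1 = a;
  act_inhabited : inhabited A
}.

#[short(type="rightActType")]
HB.structure Definition RightAct (M : monoidType) := {A of isRightAct M A}.

Section RightIdeals.
Variable M : monoidType.
Implicit Types I X : set M.

Definition right_ideal I := [set i * m | i in I & m in [set: M]] `<=` I.

Definition fg_right_ideal I := exists X,
  [/\ finite_set X, X `<=` I & I = [set x * m | x in X & m in [set: M]]].

Definition weakly_right_noetherian :=
  forall I, right_ideal I -> fg_right_ideal I.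

End RightIdeals.

Section Subacts.
Variables (M : monoidType) (A : rightActType M).
Implicit Types B U : set A.

Definition subact B := forall b (m : M), B b -> B (act b m).

(* The empty set counts as a subact; it is generated by the empty set, so
   allowing it does not affect [noetherian_act]. *)
Definition fg_subact B := exists U,
  [/\ finite_set U, U `<=` B & B = [set act u m | u in U & m in [set: M]]].

Definition fg_act := fg_subact [set: A].

Definition noetherian_act := forall B, subact B -> fg_subact B.

End Subacts.

Arguments weakly_right_noetherian : clear implicits.
Arguments fg_act {M} A.
Arguments noetherian_act {M} A.

(* Main.v *)
(** For a generator [u] of [A] and a subact [B], the set of [m] with [u m] in [B]
    is a right ideal, so it is [X_u M] with [X_u] finite; if [U] generates [A],
    then the finite union of the [u X_u], for [u] in [U], generates [B].
    Conversely, [M] acts on itself by right multiplication, is generated by [1],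
    and its subacts are the right ideals. *)
Require Import Defs.
From mathcomp Require Import all_boot.
From HB Require Import structures.
From mathcomp Require Import boolp classical_sets cardinality.

Local Open Scope group_scope.
Local Open Scope classical_set_scope.

(** The alias gives the act structure a head constant of its own, rather than keying it on the
    carrier projection of [M]. *)
Definition regular_act (M : monoidType) : Type := M.

HB.instance Definition _ (M : monoidType) :=
  @isRightAct.Build M (regular_act M) (fun a m => (a : M) * m)
    (@mulgA M) (@mulg1 M) (inhabits (1 : M)).

Lemma regular_act_fg (M : monoidType) : fg_act (regular_act M).
Proof.
exists [set (1 : M)]; split=> //.
by apply/seteqP; split=> // m _; exists 1 => //; exists m => //; apply: mul1g.
Qed.

Lemma subact_regular (M : monoidType) (I : set M) :
  right_ideal I -> @subact M (regular_act M) I.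
Proof. by move=> rI b m Ib; apply: rI; exists b => //; exists m. Qed.

Lemma right_ideal_transporter (M : monoidType) (A : rightActType M) (B : set A)
    (u : A) :
  subact B -> right_ideal [set m | B (act u m)].
Proof. by move=> sB _ [i Bi [m _ <-]] /=; rewrite actM; apply: sB. Qed.

Theorem proposition3p7 (M : monoidType) :
  weakly_right_noetherian M <->
  (forall A : rightActType M, fg_act A -> noetherian_act A).
Proof.
split=> [wnM A [U [finU _ AE]] B sB | noeth I rI]; last first.
  exact: (noeth _ (regular_act_fg M) I (subact_regular _ _ rI)).
(* Choice fixes finite generators [X u] for all [u] at once, so that their union over [U] can be
   formed. *)
have /choice[X XP] u := wnM _ (right_ideal_transporter _ _ _ u sB).
have sVB : \bigcup_(u in U) (act u @` X u) `<=` B.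
  by move=> _ [u _ [x Xx <-]]; have [_ + _] := XP u; apply.
exists (\bigcup_(u in U) (act u @` X u)); split=> //.
  apply: bigcup_finite => // u _; apply: finite_image.
  by have [] := XP u.
apply/seteqP; split=> [b Bb | _ [v Vv [m _ <-]]]; last exact/sB/sVB.
(* Write [b] as [act u n]; then [n = x * m] with [x] in [X u], so [b] is [act (act u x) m]. *)
have : [set: A] b by [].
rewrite AE => -[u Uu [n _ bE]].
have [_ _ XE] := XP u.
have : [set m | B (act u m)] n by rewrite /= bE.
rewrite XE => -[x Xx [m _ nE]].
exists (act u x); first by exists u => //; exists x.
by exists m => //; rewrite -actM nE.
Qed.
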